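(* Let $m\geq 1$ be an integer and let $\{R_i\}_{i=1,\dots,m}$ be a family of coherent commutative rings with identity. Then $$\mathrm{G\text{-}wdim}\Big(\prod_{i=1}^m R_i\Big)=\sup\{\mathrm{G\text{-}wdim}(R_i)\mid 1\leq i\leq m\}.$$
   Context: All rings are commutative with identity and all modules are unital. An $R$-module $M$ is Gorenstein flat if there is an exact sequence of flat $R$-modules $\mathbf F=\cdots\to F_1\to F_0\to F^0\to F^1\to\cdots$ with $M\cong \mathrm{Im}(F_0\to F^0)$ such that $I\otimes_R\mathbf F$ is exact for every injective $R$-module $I$. The Gorenstein flat dimension $\mathrm{Gfd}_R(M)$ is the least integer $k\ge 0$ such that there is an exact sequence $0\to G_k\to\cdots\to G_0\to M\to 0$ with all $G_i$ Gorenstein flat ($\infty$ if no such $k$ exists). The Gorenstein weak dimension of $R$ is $\mathrm{G\text{-}wdim}(R)=\sup\{\mathrm{Gfd}_R(M)\mid M \text{ an } R\text{-module}\}$ (possibly $\infty$). *)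

(* Defs.v *)
From HB Require Import structures.
From mathcomp Require Import all_boot all_order all_algebra.
From mathcomp Require Import boolp classical_sets reals ereal.

Set Implicit Arguments.
Unset Strict Implicit.
Unset Printing Implicit Defensive.

Import Order.TTheory GRing.Theory Num.Theory.
Local Open Scope ring_scope.
Local Open Scope quotient_scope.

(* MathComp's pz-rings ("possibly zero") are used throughout, so that the zero
   ring is not excluded. *)

Section ProductRing.
Variables (I : Type) (R : I -> comPzRingType).

Definition prod_ring : Type := forall i, R i.

HB.instance Definition _ := Choice.on prod_ring.

Implicit Types x y z : prod_ring.
Let zero : prod_ring := fun=> 0.
Let one : prod_ring := fun=> 1.
Let opp x : prod_ring := fun i => - x i.
Let add x y : prod_ring := fun i => x i + y i.
Let mul x y : prod_ring := fun i => x i * y i.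

Let addA : associative add.
Proof. by move=> x y z; apply: functional_extensionality_dep => i; exact: addrA.
Qed.
Let addC : commutative add.
Proof. by move=> x y; apply: functional_extensionality_dep => i; exact: addrC.
Qed.
Let add0 : left_id zero add.
Proof. by move=> x; apply: functional_extensionality_dep => i; exact: add0r.
Qed.
Let addN : left_inverse zero opp add.
Proof. by move=> x; apply: functional_extensionality_dep => i; exact: addNr.
Qed.

HB.instance Definition _ := GRing.isZmodule.Build prod_ring addA addC add0 addN.

Let mulA : associative mul.
Proof. by move=> x y z; apply: functional_extensionality_dep => i; exact: mulrA.
Qed.
Let mulC : commutative mul.
Proof. by move=> x y; apply: functional_extensionality_dep => i; exact: mulrC.
Qed.
Let mul1 : left_id one mul.
Proof. by move=> x; apply: functional_extensionality_dep => i; exact: mul1r.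
Qed.
Let mulD : left_distributive mul add.
Proof. by move=> x y z; apply: functional_extensionality_dep => i;
  exact: mulrDl.
Qed.

HB.instance Definition _ :=
  GRing.Zmodule_isComPzRing.Build prod_ring mulA mulC mul1 mulD.

End ProductRing.

Section Tensor.
Variables (R : comPzRingType) (M N : lmodType R).

(* The tensor product is the free commutative monoid on [M * N] (sequences up to
   permutation) modulo the bilinearity relations.  [tens_zero] makes [(- m, n)]
   an opposite of [(m, n)], so that this quotient is already a group. *)
Inductive tens_equiv : seq (M * N) -> seq (M * N) -> Prop :=
| tens_perm s t : perm_eq s t -> tens_equiv s t
| tens_sym s t : tens_equiv s t -> tens_equiv t s
| tens_trans s t u : tens_equiv s t -> tens_equiv t u -> tens_equiv s u
| tens_cat s1 t1 s2 t2 :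
    tens_equiv s1 t1 -> tens_equiv s2 t2 -> tens_equiv (s1 ++ s2) (t1 ++ t2)
| tens_zero n : tens_equiv [:: (0, n)] [::]
| tens_addl m m' n : tens_equiv [:: (m + m', n)] [:: (m, n); (m', n)]
| tens_addr m n n' : tens_equiv [:: (m, n + n')] [:: (m, n); (m, n')]
| tens_scale a m n : tens_equiv [:: (a *: m, n)] [:: (m, a *: n)].

Definition tens_rel : rel (seq (M * N)) := fun s t => `[< tens_equiv s t >].

Lemma tens_rel_equiv : equiv_class_of tens_rel.
Proof.
split=> [s|s t|t s u].
- exact/asboolP/tens_perm.
- by apply/asboolP/asboolP; exact: tens_sym.
- by move=> /asboolP st /asboolP tu; apply/asboolP/(tens_trans st tu).
Qed.

Canonical tens_equiv_rel := EquivRelPack tens_rel_equiv.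

Definition tensor : Type := {eq_quot tens_rel}.

HB.instance Definition _ := Choice.on tensor.
HB.instance Definition _ := EqQuotient.on tensor.

Lemma tens_piP (s t : seq (M * N)) :
  reflect (\pi_tensor s = \pi_tensor t) `[< tens_equiv s t >].
Proof. exact: eqmodP. Qed.

Lemma tens_reprP (s : seq (M * N)) : tens_equiv (repr (\pi_tensor s)) s.
Proof. by apply/asboolP/tens_piP; rewrite reprK. Qed.

Let scale_seq (a : R) (s : seq (M * N)) := [seq (a *: p.1, p.2) | p <- s].

Lemma tens_scale_seq a s t :
  tens_equiv s t -> tens_equiv (scale_seq a s) (scale_seq a t).
Proof.
elim=> {s t} [s t st|s t _|s t u _ st _|s1 t1 s2 t2 _ h1 _ h2|n|m m' n|m n n'|
  b m n] /=.
- exact/tens_perm/perm_map.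
- exact: tens_sym.
- exact: tens_trans.
- by rewrite /scale_seq !map_cat; exact: tens_cat.
- by rewrite scaler0; exact: tens_zero.
- by rewrite scalerDr; exact: tens_addl.
- exact: tens_addr.
- by rewrite scalerA mulrC -scalerA; exact: tens_scale.
Qed.

Definition tens_add (x y : tensor) : tensor := \pi_tensor (repr x ++ repr y).
Definition tens_scalar (a : R) (x : tensor) : tensor :=
  \pi_tensor (scale_seq a (repr x)).

Lemma tens_addE s t :
  tens_add (\pi_tensor s) (\pi_tensor t) = \pi_tensor (s ++ t).
Proof.
by apply/tens_piP/asboolP/tens_cat; exact: tens_reprP.
Qed.

Lemma tens_scalarE a s :
  tens_scalar a (\pi_tensor s) = \pi_tensor (scale_seq a s).
Proof. by apply/tens_piP/asboolP/tens_scale_seq/tens_reprP. Qed.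

Fact tens_addA : associative tens_add.
Proof.
move=> x y z; rewrite -[x]reprK -[y]reprK -[z]reprK.
move: (repr x) (repr y) (repr z) => s t u.
by rewrite (tens_addE t u) (tens_addE s t) (tens_addE s) (tens_addE _ u) catA.
Qed.

Fact tens_addC : commutative tens_add.
Proof.
move=> x y; rewrite -[x]reprK -[y]reprK; move: (repr x) (repr y) => s t.
rewrite !tens_addE.
by apply/tens_piP/asboolP/tens_perm; rewrite perm_catC.
Qed.

Fact tens_add0 : left_id (\pi_tensor [::]) tens_add.
Proof. by move=> x; rewrite -[x]reprK tens_addE. Qed.

Fact tens_addN : left_inverse (\pi_tensor [::]) (tens_scalar (-1)) tens_add.
Proof.
move=> x; rewrite -[x]reprK; move: (repr x) => s.
rewrite tens_scalarE tens_addE; apply/tens_piP/asboolP.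
elim: s => [|[m n] s IH]; first exact: tens_perm.
apply: (@tens_trans _
  (([:: (-1 *: m, n)] ++ [:: (m, n)]) ++ (scale_seq (-1) s ++ s))).
  by apply: tens_perm; rewrite /= perm_cons perm_catC /= perm_cons perm_catC.
rewrite -[[::]]/([::] ++ [::]); apply: tens_cat IH.
apply: tens_trans (tens_zero n).
by rewrite -[0](addNr m) scaleN1r; apply: tens_sym; exact: tens_addl.
Qed.

HB.instance Definition _ :=
  GRing.isZmodule.Build tensor tens_addA tens_addC tens_add0 tens_addN.

Lemma tens_pi_cat s t : \pi_tensor (s ++ t) = \pi_tensor s + \pi_tensor t.
Proof. by rewrite [RHS]tens_addE. Qed.

Fact tens_scalerA a b (x : tensor) :
  tens_scalar a (tens_scalar b x) = tens_scalar (a * b) x.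
Proof.
rewrite -[x]reprK; move: (repr x) => s.
rewrite (tens_scalarE b) (tens_scalarE a) (tens_scalarE (a * b)).
suff -> : scale_seq a (scale_seq b s) = scale_seq (a * b) s by [].
by rewrite /scale_seq -map_comp; apply: eq_map => p /=; rewrite scalerA.
Qed.

Fact tens_scale1 : left_id 1 tens_scalar.
Proof.
move=> x; rewrite -[x]reprK; move: (repr x) => s; rewrite (tens_scalarE 1).
suff -> : scale_seq 1 s = s by [].
by rewrite -[RHS]map_id; apply: eq_map => -[m n] /=; rewrite scale1r.
Qed.

Fact tens_scalerDr : right_distributive tens_scalar +%R.
Proof.
move=> a x y; rewrite -[x]reprK -[y]reprK; move: (repr x) (repr y) => s t.
rewrite -tens_pi_cat !(tens_scalarE a) -tens_pi_cat.
by rewrite /scale_seq map_cat.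
Qed.

Fact tens_scalerDl x : {morph tens_scalar^~ x : a b / a + b}.
Proof.
move=> a b; rewrite -[x]reprK; move: (repr x) => s.
rewrite (tens_scalarE (a + b)) (tens_scalarE a) (tens_scalarE b).
elim: s => [|[m n] s IH]; first by rewrite /= addr0.
rewrite -cat1s /scale_seq !map_cat !tens_pi_cat addrACA -IH; congr (_ + _).
rewrite -tens_pi_cat; apply/tens_piP/asboolP => /=.
by rewrite scalerDl; exact: tens_addl.
Qed.

HB.instance Definition _ := GRing.Zmodule_isLmodule.Build R tensor
  tens_scalerA tens_scale1 tens_scalerDr tens_scalerDl.

Definition tens (m : M) (n : N) : tensor := \pi_tensor [:: (m, n)].

Lemma tensDl m m' n : tens (m + m') n = tens m n + tens m' n.
Proof. by rewrite -tens_pi_cat; apply/tens_piP/asboolP/tens_addl. Qed.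

Lemma tensDr m n n' : tens m (n + n') = tens m n + tens m n'.
Proof. by rewrite -tens_pi_cat; apply/tens_piP/asboolP/tens_addr. Qed.

Lemma tensZl a m n : tens (a *: m) n = a *: tens m n.
Proof. by rewrite [RHS]tens_scalarE. Qed.

Lemma tensZr a m n : tens m (a *: n) = a *: tens m n.
Proof.
by rewrite -tensZl; apply/tens_piP/asboolP/tens_sym/tens_scale.
Qed.

Lemma tens_pi_sum s : \pi_tensor s = \sum_(p <- s) tens p.1 p.2.
Proof.
elim: s => [|[m n] s IH]; first by rewrite big_nil.
by rewrite big_cons -cat1s tens_pi_cat IH.
Qed.

Section Lift.
Variables (T : lmodType R) (b : M -> N -> T).
Hypothesis bDl : forall m m' n, b (m + m') n = b m n + b m' n.
Hypothesis bDr : forall m n n', b m (n + n') = b m n + b m n'.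
Hypothesis bZl : forall a m n, b (a *: m) n = a *: b m n.
Hypothesis bZr : forall a m n, b m (a *: n) = a *: b m n.

Definition tens_lift_fun (x : tensor) : T := \sum_(p <- repr x) b p.1 p.2.

Lemma tens_lift_equiv s t : tens_equiv s t ->
  \sum_(p <- s) b p.1 p.2 = \sum_(p <- t) b p.1 p.2.
Proof.
elim=> {s t} [s t st|s t _ ->|s t u _ -> _ ->|s1 t1 s2 t2 _ h1 _ h2|n|m m' n|
  m n n'|a m n] //.
- exact: perm_big.
- by rewrite !big_cat h1 h2.
- by rewrite big_seq1 big_nil -[X in b X](scale0r 0) bZl scale0r.
- by rewrite !big_cons !big_nil !addr0 bDl.
- by rewrite !big_cons !big_nil !addr0 bDr.
- by rewrite !big_seq1 bZl bZr.
Qed.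

Lemma tens_lift_pi s : tens_lift_fun (\pi_tensor s) = \sum_(p <- s) b p.1 p.2.
Proof. exact/tens_lift_equiv/tens_reprP. Qed.

Lemma tens_lift_linear : linear tens_lift_fun.
Proof.
move=> a x y; rewrite -[x]reprK -[y]reprK; move: (repr x) (repr y) => s t.
have -> : a *: \pi_tensor s = \pi_tensor (scale_seq a s) by exact: tens_scalarE.
rewrite -tens_pi_cat !tens_lift_pi big_cat /scale_seq big_map scaler_sumr.
by congr (_ + _); apply: eq_bigr => p _; rewrite bZl.
Qed.

Definition tens_lift : {linear tensor -> T} :=
  HB.pack tens_lift_fun (GRing.isLinear.Build R tensor T *:%R tens_lift_fun
    tens_lift_linear).

Lemma tens_liftE m n : tens_lift (tens m n) = b m n.
Proof. by rewrite [LHS]tens_lift_pi big_seq1. Qed.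

Lemma tens_lift_uniq (g : {linear tensor -> T}) :
  (forall m n, g (tens m n) = b m n) -> g =1 tens_lift.
Proof.
move=> gE x; rewrite -[x]reprK; move: (repr x) => s; rewrite tens_pi_sum.
rewrite !linear_sum.
by apply: eq_bigr => p _; rewrite (gE p.1 p.2) tens_liftE.
Qed.

End Lift.
End Tensor.

Section TensorMap.
Variables (R : comPzRingType) (M M' N N' : lmodType R).
Variables (f : {linear M -> M'}) (g : {linear N -> N'}).

Definition tens_map : {linear tensor M N -> tensor M' N'}.
Proof.
apply: (@tens_lift _ _ _ _ (fun m n => tens (f m) (g n))).
- by move=> m m' n; rewrite linearD tensDl.
- by move=> m n n'; rewrite linearD tensDr.
- by move=> a m n; rewrite linearZ tensZl.
- by move=> a m n; rewrite linearZ tensZr.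
Defined.

Lemma tens_mapE m n : tens_map (tens m n) = tens (f m) (g n).
Proof. exact: tens_liftE. Qed.

End TensorMap.

Section Modules.
Variable R : comPzRingType.
Implicit Types M I : lmodType R.

Definition exact_at (A B C : lmodType R) (f : A -> B) (g : B -> C) : Prop :=
  forall y, g y = 0 <-> exists x, f x = y.

Definition surjective_map (A B : Type) (f : A -> B) : Prop :=
  forall y, exists x, f x = y.

Definition finitely_generated M : Prop :=
  exists (n : nat) (g : {linear 'rV[R]_n -> M}), surjective_map g.

Definition finitely_presented M : Prop :=
  exists (n k : nat) (f : {linear 'rV[R]_k -> 'rV[R]_n})
    (g : {linear 'rV[R]_n -> M}), exact_at f g /\ surjective_map g.

(* Every finitely generated ideal is finitely presented; an ideal is given, as a
   module, by an injective linear map into the regular module [R^o]. *)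
Definition coherent : Prop :=
  forall (J : lmodType R) (j : {linear J -> R^o}),
    injective j -> finitely_generated J -> finitely_presented J.

Definition flat M : Prop :=
  forall (A B : lmodType R) (f : {linear A -> B}),
    injective f -> injective (tens_map (@idfun M) f).

Definition injective_module I : Prop :=
  forall (A B : lmodType R) (j : {linear A -> B}) (f : {linear A -> I}),
    injective j -> exists g : {linear B -> I}, forall x, g (j x) = f x.

Record seq_mod := SeqMod {
  term : int -> lmodType R;
  diff : forall i, {linear term i -> term (i + 1)} }.

Definition exact_seq (K : seq_mod) : Prop :=
  forall i, exact_at (@diff K i) (@diff K (i + 1)).

Definition tens_seq I (K : seq_mod) : seq_mod :=
  @SeqMod (fun i => tensor I (term K i))
    (fun i => tens_map (@idfun I) (@diff K i)).

(* With the indexing of [seq_mod], [F_j] is [term F (- j)] and [F^j] is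
   [term F (j + 1)]; [e] identifies [M] with the image of [F_0 -> F^0]. *)
Definition gorenstein_flat M : Prop :=
  exists F : seq_mod,
    [/\ forall i, flat (term F i),
        exact_seq F,
        exists2 e : {linear M -> term F (0 + 1)}, injective e &
          forall y, (exists x, e x = y) <-> (exists z, @diff F 0 z = y)
      & forall I, injective_module I -> exact_seq (tens_seq I F)].

(* An exact sequence [0 -> G_k -> ... -> G_0 -> M -> 0] of Gorenstein flat
   modules, extended by zero modules to the left. *)
Definition gflat_resolution M (k : nat) : Prop :=
  exists (G : nat -> lmodType R) (d : forall i, {linear G i.+1 -> G i})
    (eps : {linear G 0%N -> M}),
    [/\ forall i, (i <= k)%N -> gorenstein_flat (G i),
        forall i, (k < i)%N -> forall x : G i, x = 0,
        surjective_map eps,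
        exact_at (d 0%N) eps
      & forall i, exact_at (d i.+1) (d i)].

(* [K] only provides the real numbers of the extended real line [\bar K]. *)
Definition Gfd (K : realType) M : \bar K :=
  match pselect (exists k, `[< gflat_resolution M k >]) with
  | left ex_k => (ex_minn ex_k)%:R%:E
  | right _ => +oo%E
  end.

Definition Gwdim (K : realType) : \bar K :=
  ereal_sup [set x | exists M : lmodType R, x = Gfd K M]%classic.

End Modules.

Arguments coherent R : clear implicits.
Arguments Gwdim R K : clear implicits.

(* Main.v *)
From HB Require Import structures.
Require Import Defs.
From mathcomp Require Import all_boot all_order all_algebra.
From mathcomp Require Import boolp classical_sets reals ereal.

(** Let e_i be the idempotent of S = prod_i R_i cutting out R_i.  An S-module M
    is recovered from its components e_i M, and M |-> e_i M is exact, commutes with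
    tensor products and preserves injectives, while restriction of scalars from
    R_i to S is exact and preserves injectives.  Hence flatness, Gorenstein
    flatness and Gorenstein flat resolutions of length k pass from M to each
    e_i M, and back as soon as all the components have them.  A Gorenstein flat
    resolution may be lengthened by zeros, so Gfd M = max_i Gfd (e_i M). *)

Set Implicit Arguments.
Unset Strict Implicit.
Unset Printing Implicit Defensive.

Import Order.TTheory GRing.Theory Num.Theory.
Local Open Scope ring_scope.
Local Open Scope quotient_scope.

(** * Preliminaries on tensors and linear maps *)

Lemma tensor_ind (R : comPzRingType) (M N : lmodType R)
    (P : tensor M N -> Prop) :
  P 0 -> (forall m n x, P x -> P (tens m n + x)) -> forall x, P x.
Proof.
move=> P0 PD x; rewrite -[x]reprK tens_pi_sum.
elim: (repr x) => [|p s IH]; first by rewrite big_nil.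
by rewrite big_cons; exact: PD.
Qed.

Section Linear.
Variables (R : comPzRingType) (M N : lmodType R).

Definition mk_linear (f : M -> N) (lf : linear f) : {linear M -> N} :=
  HB.pack f (GRing.isLinear.Build R M N *:%R f lf).

Lemma linear_inj (f : {linear M -> N}) :
  (forall x, f x = 0 -> x = 0) -> injective f.
Proof.
by move=> f0 x y fxy; apply: subr0_eq; apply: f0; rewrite linearB fxy subrr.
Qed.

End Linear.

(* [R] is a direct factor of [S]: [incl] is the non-unital embedding of [R] onto
   the ideal of [S] generated by the idempotent [incl 1]. *)
Record factor (S R : comPzRingType) := Factor {
  proj : {rmorphism S -> R};
  incl : R -> S;
  inclK : cancel incl proj;
  projK : forall s, incl (proj s) = incl 1 * s }.

Definition idem S R (phi : factor S R) : S := incl phi 1.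

(** * Arithmetic of the idempotent of a direct factor *)

Section FactorTheory.
Variables (S R : comPzRingType) (phi : factor S R).
Local Notation e := (idem phi).

Lemma idem_incl r : e * incl phi r = incl phi r.
Proof. by rewrite -projK inclK. Qed.

(** Additivity is forced: [r + r'] is [proj] of the sum of the lifts, and [incl] after [proj] is
    multiplication by [e], which fixes the values of [incl]. *)
Lemma inclD r r' : incl phi (r + r') = incl phi r + incl phi r'.
Proof.
by rewrite -{1}[r](inclK phi) -{1}[r'](inclK phi) -rmorphD projK mulrDr
  !idem_incl.
Qed.

Lemma inclM r r' : incl phi (r * r') = incl phi r * incl phi r'.
Proof.
by rewrite -{1}[r](inclK phi) -{1}[r'](inclK phi) -rmorphM projK mulrA
  idem_incl.
Qed.

Lemma proj_idem : proj phi e = 1.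
Proof. exact: inclK. Qed.

End FactorTheory.

(** * Restriction of scalars from the factor *)

Section Restrict.
Variables (S R : comPzRingType) (phi : factor S R) (N : lmodType R).

(* The dummy [let] keeps [phi] in the name of the type, from which the scalar
   action is inferred. *)
Definition restrict : Type := let _ := phi in N.

HB.instance Definition _ := GRing.Zmodule.on restrict.

Let scale (s : S) (x : restrict) : restrict := proj phi s *: (x : N).

Let scaleA a b x : scale a (scale b x) = scale (a * b) x.
Proof. by rewrite /scale scalerA rmorphM. Qed.
Let scale1 : left_id 1 scale.
Proof. by move=> x; rewrite /scale rmorph1 scale1r. Qed.
Let scaleDr : right_distributive scale +%R.
Proof. by move=> a x y; exact: scalerDr. Qed.
Let scaleDl x : {morph scale^~ x : a b / a + b}.
Proof. by move=> a b; rewrite /scale rmorphD scalerDl. Qed.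

HB.instance Definition _ :=
  GRing.Zmodule_isLmodule.Build S restrict scaleA scale1 scaleDr scaleDl.

Lemma restrictZ (s : S) (x : restrict) : s *: x = proj phi s *: (x : N).
Proof. by []. Qed.

End Restrict.

(** * The summand e M as a module over the factor *)

Section Part.
Variables (S R : comPzRingType) (phi : factor S R) (M : lmodType S).
Local Notation e := (idem phi).

(** Since [e] is idempotent, its fixed points are exactly e M; the equation is a boolean predicate,
    as a subtype requires. *)
Definition fixed : pred M := fun x => e *: x == x.

Lemma fixed_zmod_closed : zmod_closed fixed.
Proof.
split=> [|x y]; rewrite ?unfold_in /fixed ?scaler0 //.
by move=> /eqP ex /eqP ey; rewrite scalerBr ex ey.
Qed.

HB.instance Definition _ := GRing.isZmodClosed.Build M fixed fixed_zmod_closed.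

Record part := Part { part_val : M; _ : part_val \in fixed }.

HB.instance Definition _ := [isSub for part_val].
HB.instance Definition _ := [Choice of part by <:].
HB.instance Definition _ := [SubChoice_isSubZmodule of part by <:].

Lemma part_fixed (x : part) : e *: part_val x = part_val x.
Proof. by case: x => x /= /eqP. Qed.

Lemma incl_fixed r (x : M) : incl phi r *: x \in fixed.
Proof. by rewrite unfold_in /fixed scalerA idem_incl. Qed.

Lemma part_valD (x y : part) : part_val (x + y) = part_val x + part_val y.
Proof. exact: (raddfD val). Qed.

(** The scalar [r] acts through [incl]; this is unital because [incl 1 = e] is the identity on e
    M. *)
Let scale (r : R) (x : part) : part := Part (incl_fixed r (part_val x)).

Let scaleA a b x : scale a (scale b x) = scale (a * b) x.
Proof. by apply: val_inj; rewrite /= scalerA inclM. Qed.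
Let scale1 : left_id 1 scale.
Proof. by move=> x; apply: val_inj; exact: part_fixed. Qed.
Let scaleDr : right_distributive scale +%R.
Proof. by move=> a x y; apply: val_inj; exact: scalerDr. Qed.
Let scaleDl x : {morph scale^~ x : a b / a + b}.
Proof. by move=> a b; apply: val_inj; rewrite /= inclD scalerDl. Qed.

HB.instance Definition _ :=
  GRing.Zmodule_isLmodule.Build R part scaleA scale1 scaleDr scaleDl.

Definition to_part (x : M) : part := Part (incl_fixed 1 x).

End Part.

(* [N] is, up to isomorphism, the [R]-module [e M]: [cq] embeds [N] in [M] with
   image [e M], and [cp] is the projection.  Such data relates [M] to
   [part], [restrict N] to [N], and a product module to its factors. *)
Record component S R (phi : factor S R) (M : lmodType S) (N : lmodType R) :=
  Component {
    cp : M -> N;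
    cq : N -> M;
    cpD : {morph cp : x y / x + y};
    cpZ : forall s x, cp (s *: x) = proj phi s *: cp x;
    cqK : cancel cq cp;
    cpK : forall x, cq (cp x) = idem phi *: x }.

Section ComponentTheory.
Variables (S R : comPzRingType) (phi : factor S R).
Variables (M : lmodType S) (N : lmodType R) (c : component phi M N).
Local Notation e := (idem phi).

Lemma cp_incl r x : cp c (incl phi r *: x) = r *: cp c x.
Proof. by rewrite cpZ inclK. Qed.

Lemma cp_idem x : cp c (e *: x) = cp c x.
Proof. by rewrite cp_incl scale1r. Qed.

Lemma cp0 : cp c 0 = 0.
Proof. by rewrite -(scale0r 0) cpZ rmorph0 scale0r. Qed.

Lemma cq0 : cq c 0 = 0.
Proof. by rewrite -cp0 (cpK c) scaler0. Qed.

Lemma idem_cq y : e *: cq c y = cq c y.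
Proof. by rewrite -(cpK c) cqK. Qed.

(** Additivity of [cq] comes from that of [cp], because [cq] inverts [cp] on e M. *)
Lemma cqD : {morph cq c : x y / x + y}.
Proof.
by move=> x y; rewrite -{1}[x](cqK c) -{1}[y](cqK c) -cpD cpK scalerDr !idem_cq.
Qed.

Lemma cqZ r y : cq c (r *: y) = incl phi r *: cq c y.
Proof. by rewrite -{1}[y](cqK c) -cp_incl cpK scalerA idem_incl. Qed.

(** On e M the scalar [s] acts as [e * s = incl (proj s)]; so [cq] is [S]-linear on the restriction
    of [N]. *)
Lemma cq_proj s y : cq c (proj phi s *: y) = s *: cq c y.
Proof. by rewrite cqZ projK mulrC -scalerA idem_cq. Qed.

End ComponentTheory.

(** * Maps between modules and the induced maps between components *)

Definition compat S R (phi : factor S R) (M M' : lmodType S) (N N' : lmodType R)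
    (c : component phi M N) (c' : component phi M' N')
    (f : M -> M') (g : N -> N') : Prop :=
  forall x, cp c' (f x) = g (cp c x).

Section CompatTheory.
Variables (S R : comPzRingType) (phi : factor S R).

Section Maps.
Variables (M M' : lmodType S) (N N' : lmodType R).
Variables (c : component phi M N) (c' : component phi M' N').
Variables (f : {linear M -> M'}).

(** The square with [cq] follows from the one with [cp]: [f] commutes with [e], and [cq] after [cp]
    is multiplication by [e]. *)
Lemma compat_cq (g : N -> N') y : compat c c' f g -> cq c' (g y) = f (cq c y).
Proof. by move=> fg; rewrite -{1}[y](cqK c) -fg cpK -linearZ idem_cq. Qed.

Lemma comp_map_linear : linear (fun y => cp c' (f (cq c y))).
Proof.
by move=> r x y; rewrite cqD cqZ linearD linearZ cpD cp_incl.
Qed.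

Definition comp_map : {linear N -> N'} := mk_linear comp_map_linear.

Lemma compat_comp_map : compat c c' f comp_map.
Proof. by move=> x; rewrite /comp_map /= cpK linearZ cp_idem. Qed.

Lemma compat_inj (g : {linear N -> N'}) :
  compat c c' f g -> injective f -> injective g.
Proof.
move=> fg fI; apply: linear_inj => y gy0; rewrite -[y](cqK c).
suff -> : cq c y = 0 by rewrite cp0.
by apply: fI; rewrite -(compat_cq _ fg) gy0 cq0 linear0.
Qed.

Lemma compat_surj (g : {linear N -> N'}) :
  compat c c' f g -> surjective_map f -> surjective_map g.
Proof.
move=> fg fS y; have [x fx] := fS (cq c' y).
by exists (cp c x); rewrite -fg fx cqK.
Qed.

End Maps.

(** [cq] lifts a cycle of the component to a cycle of the [S]-sequence, and [cp] brings a preimage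
    back. *)
Lemma compat_exact (A B C : lmodType S) (A' B' C' : lmodType R)
    (a : component phi A A') (b : component phi B B') (c : component phi C C')
    (f : {linear A -> B}) (g : {linear B -> C})
    (f' : {linear A' -> B'}) (g' : {linear B' -> C'}) :
  compat a b f f' -> compat b c g g' -> exact_at f g -> exact_at f' g'.
Proof.
move=> ff' gg' ex y; split=> [gy0|[x <-]].
  have /ex[x fx] : g (cq b y) = 0 by rewrite -(compat_cq _ gg') gy0 cq0.
  by exists (cp a x); rewrite -ff' fx cqK.
have gf0 : g (f (cq a x)) = 0 by apply/ex; exists (cq a x).
by rewrite -[x](cqK a) -ff' -gg' gf0 cp0.
Qed.

End CompatTheory.

(** * Components of restrictions and of tensor products *)

Section Constructions.
Variables (S R : comPzRingType) (phi : factor S R).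

Definition restrict_component (N : lmodType R) :
  component phi (restrict phi N) N.
Proof.
apply: (@Component _ _ _ (restrict phi N) N (fun x => x) (fun x => x)) => //.
by move=> x; rewrite restrictZ proj_idem scale1r.
Defined.

Definition restrict_map (N N' : lmodType R) (f : {linear N -> N'}) :
  {linear restrict phi N -> restrict phi N'}.
Proof.
apply: (@mk_linear _ (restrict phi N) (restrict phi N') f) => s x y.
by rewrite !restrictZ -linearZ -linearD.
Defined.

Definition part_component (M : lmodType S) : component phi M (part phi M).
Proof.
apply: (@Component _ _ _ M (part phi M) (@to_part _ _ phi M)
  (@part_val _ _ phi M)).
- by move=> x y; apply: val_inj; exact: scalerDr.
- by move=> s x; apply: val_inj; rewrite /= projK !scalerA mulrAC idem_incl.
- by move=> x; apply: val_inj; exact: part_fixed.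
- by [].
Defined.

Section TensorComponent.
Variables (M N : lmodType S) (M' N' : lmodType R).
Variables (c : component phi M M') (d : component phi N N').

(** The universal property over [S] needs an [S]-module as target, hence the restriction of
    scalars. *)
Definition tens_cp :
  {linear tensor M N -> restrict phi (tensor M' N')}.
Proof.
apply: (@tens_lift _ _ _ (restrict phi (tensor M' N'))
  (fun m n => tens (cp c m) (cp d n))).
- by move=> m m' n; rewrite cpD; exact: tensDl.
- by move=> m n n'; rewrite cpD; exact: tensDr.
- by move=> a m n; rewrite cpZ restrictZ; exact: tensZl.
- by move=> a m n; rewrite cpZ restrictZ; exact: tensZr.
Defined.

Lemma tens_cpE m n : tens_cp (tens m n) = tens (cp c m) (cp d n).
Proof. exact: tens_liftE. Qed.

(** Over [R] the target must be an [R]-module: the part of [tensor M N] fixed by [e] is one. *)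
Definition tens_cq : {linear tensor M' N' -> part phi (tensor M N)}.
Proof.
apply: (@tens_lift _ _ _ (part phi (tensor M N))
  (fun m n => to_part phi (tens (cq c m) (cq d n)))).
- by move=> m m' n; rewrite cqD tensDl; exact: (cpD (part_component _)).
- by move=> m n n'; rewrite cqD tensDr; exact: (cpD (part_component _)).
- move=> a m n; rewrite cqZ tensZl; exact: (cp_incl (part_component _)).
- move=> a m n; rewrite cqZ tensZr; exact: (cp_incl (part_component _)).
Defined.

Lemma tens_cqE m n : part_val (tens_cq (tens m n)) = tens (cq c m) (cq d n).
Proof. by rewrite [tens_cq _]tens_liftE /= -tensZl idem_cq. Qed.

Definition tens_component : component phi (tensor M N) (tensor M' N').
Proof.
apply: (@Component _ _ _ (tensor M N) (tensor M' N')
  tens_cp (fun x => part_val (tens_cq x))).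
- exact: (linearD tens_cp).
- by move=> s x; rewrite linearZ.
- elim/tensor_ind=> [|m n x IH]; first by rewrite !linear0.
  by rewrite linearD part_valD linearD {}IH tens_cqE tens_cpE !cqK.
- elim/tensor_ind=> [|m n x IH].
    by rewrite scaler0 !linear0.
  (* On a pure tensor [e] is applied to both factors, which is the same as applying it once since
     [e * e = e]. *)
  rewrite scalerDr !linearD part_valD IH tens_cpE tens_cqE !cpK.
  by rewrite tensZl tensZr scalerA idem_incl.
Defined.

Lemma tens_componentE m n :
  cp tens_component (tens m n) = tens (cp c m) (cp d n).
Proof. exact: tens_cpE. Qed.

End TensorComponent.

Section TensorCompat.
Variables (M1 M2 N1 N2 : lmodType S) (M1' M2' N1' N2' : lmodType R).
Variables (c1 : component phi M1 M1') (c2 : component phi M2 M2').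
Variables (d1 : component phi N1 N1') (d2 : component phi N2 N2').
Variables (f : {linear M1 -> M2}) (g : {linear N1 -> N2}).
Variables (f' : {linear M1' -> M2'}) (g' : {linear N1' -> N2'}).

Lemma tens_compat : compat c1 c2 f f' -> compat d1 d2 g g' ->
  compat (tens_component c1 d1) (tens_component c2 d2)
    (tens_map f g) (tens_map f' g').
Proof.
move=> ff' gg'; elim/tensor_ind=> [|m n x IH].
  by rewrite linear0 !cp0 linear0.
rewrite linearD !cpD linearD IH; congr (_ + _).
by rewrite tens_mapE !tens_componentE tens_mapE ff' gg'.
Qed.

End TensorCompat.

(** * Descent of flatness, injectivity and resolutions to a component *)

Lemma compat_id (M : lmodType S) (N : lmodType R) (c : component phi M N) :
  compat c c (@idfun M) (@idfun N).
Proof. by []. Qed.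

(** Restricting a test injection to [S] keeps it injective; tensoring with [M] and taking components
    gives the map to be tested for [N]. *)
Lemma component_flat (M : lmodType S) (N : lmodType R) :
  component phi M N -> flat M -> flat N.
Proof.
move=> c Mflat A B f fI.
have cf : compat (restrict_component A) (restrict_component B)
  (restrict_map f) f by [].
apply: compat_inj (tens_compat (compat_id c) cf) _; apply: Mflat.
exact: fI.
Qed.

(** A map from [A] into a restricted module factors through e A, so the extension problem is solved
    over [R] on e A and e B, then composed with the projection of [B]. *)
Lemma restrict_injective (I : lmodType R) :
  injective_module I -> injective_module (restrict phi I).
Proof.
move=> Iinj A B j f jI.
pose a := part_component A; pose b := part_component B.
pose r := restrict_component I.
have [g gj] := Iinj _ _ (comp_map a b j) (comp_map a r f)
  (compat_inj (compat_comp_map a b j) jI).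
have lg : linear (fun x => g (cp b x) : restrict phi I).
  by move=> s x y; rewrite cpD cpZ linearD linearZ restrictZ.
exists (mk_linear lg) => x; rewrite -[LHS]/(g (cp b (j x))).
by rewrite (compat_comp_map a b) gj -(compat_comp_map a r).
Qed.

(** The extension problem is restricted to [S], solved in [I] after embedding [J] by [cq], and
    projected back by [cp]. *)
Lemma component_injective (I : lmodType S) (J : lmodType R) :
  component phi I J -> injective_module I -> injective_module J.
Proof.
move=> c Iinj A B j f jI.
have lf : linear (fun x : restrict phi A => cq c (f x)).
  by move=> s x y; rewrite linearD linearZ cqD cq_proj.
have [g gj] := Iinj _ _ (restrict_map j) (mk_linear lf) jI.
have lg : linear (fun x : B => cp c (g x)).
  move=> r x y.
  (* The [R]-action on [B] is rewritten as an [S]-action so that linearity of [g] applies. *)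
  have -> : r *: x + y = incl phi r *: (x : restrict phi B) + y.
    by rewrite restrictZ inclK.
  by rewrite linearD linearZ cpD cp_incl.
by exists (mk_linear lg) => x /=; rewrite gj /= cqK.
Qed.

Definition part_seq (F : seq_mod S) : seq_mod R :=
  @SeqMod R (fun i => part phi (term F i))
    (fun i => comp_map (part_component _) (part_component _) (@diff _ F i)).

(** The witness is the complex e F. For [I] injective over [R], tensoring e F with [I] is a
    component of tensoring F with the restriction of [I], which is injective over [S]. *)
Lemma component_gflat (M : lmodType S) (N : lmodType R) :
  component phi M N -> gorenstein_flat M -> gorenstein_flat N.
Proof.
move=> c [F [Fflat Fex [e eI eim] IF]]; exists (part_seq F); split.
- by move=> i; exact: component_flat (part_component _) (Fflat i).
- by move=> i; apply: compat_exact (Fex i); exact: compat_comp_map.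
- pose p i := part_component (term F i).
  exists (comp_map c (p (0 + 1)) e); 
    first exact: compat_inj (compat_comp_map _ _ _) eI.
  move=> y; split=> [[x <-]|[z <-]].
    have /eim[z ze] : exists x', e x' = e (cq c x) by exists (cq c x).
    exists (cp (p 0) z); rewrite -[LHS]compat_comp_map ze.
    by rewrite (compat_comp_map c) cqK.
  have /eim[x xe] :
    exists z', diff F 0 z' = diff F 0 (cq (p 0) z) by exists (cq (p 0) z).
  exists (cp c x); rewrite -compat_comp_map xe.
  by rewrite (compat_comp_map (p 0)) cqK.
- move=> I Iinj i; pose p i := part_component (term F i).
  pose r := restrict_component I.
  have tp j : compat (tens_component r (p j)) (tens_component r (p (j + 1)))
      (tens_map idfun (diff F j)) (tens_map idfun (diff (part_seq F) j)).
    exact: tens_compat (compat_id r) (compat_comp_map (p j) (p (j + 1)) _).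
  exact: compat_exact (tp i) (tp (i + 1)) (IF _ (restrict_injective Iinj) i).
Qed.

Lemma component_resolution (M : lmodType S) (N : lmodType R) k :
  component phi M N -> gflat_resolution M k -> gflat_resolution N k.
Proof.
move=> c [G [d [eps [Ggf G0 eS ex0 ex]]]].
pose p i := part_component (G i).
exists (fun i => part phi (G i)), (fun i => comp_map (p i.+1) (p i) (d i)),
  (comp_map (p 0%N) c eps); split.
- by move=> i /Ggf; apply: component_gflat.
- by move=> i ki x; apply: val_inj; exact: G0.
- by apply: compat_surj eS; exact: compat_comp_map.
- by apply: compat_exact ex0; exact: compat_comp_map.
- by move=> i; apply: compat_exact (ex i); exact: compat_comp_map.
Qed.

End Constructions.

(** * Zero modules and lengthening of resolutions *)

Section ZeroModule.
Variable R : comPzRingType.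

Lemma tensor_zero (M N : lmodType R) :
  (forall m : M, m = 0) -> forall x : tensor M N, x = 0.
Proof.
move=> M0; elim/tensor_ind=> [//|m n x ->].
by rewrite addr0 (M0 m) -(scale0r 0) tensZl scale0r.
Qed.

Lemma tensor_zeror (M N : lmodType R) :
  (forall n : N, n = 0) -> forall x : tensor M N, x = 0.
Proof.
move=> N0; elim/tensor_ind=> [//|m n x ->].
by rewrite addr0 (N0 n) -(scale0r 0) tensZr scale0r.
Qed.

Lemma zero_exact (A B C : lmodType R) (f : {linear A -> B})
    (g : {linear B -> C}) : (forall b : B, b = 0) -> exact_at f g.
Proof.
by move=> B0 y; rewrite (B0 y) linear0; split=> // _; exists 0; exact: B0.
Qed.

Lemma zero_gflat (M : lmodType R) : (forall x : M, x = 0) -> gorenstein_flat M.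
Proof.
move=> M0; exists (@SeqMod R (fun=> M) (fun=> @idfun M)); split.
- by move=> i A B f fI; apply: linear_inj => x _; exact: tensor_zero.
- by move=> i; exact: zero_exact.
- by exists (@idfun M).
- by move=> I Iinj i; apply: zero_exact; exact: tensor_zeror.
Qed.

(** The same resolution serves: its terms in degrees above [k] vanish, and zero modules are
    Gorenstein flat. *)
Lemma gflat_resolution_leq (M : lmodType R) k n :
  (k <= n)%N -> gflat_resolution M k -> gflat_resolution M n.
Proof.
move=> kn [G [d [eps [Ggf G0 eS ex0 ex]]]]; exists G, d, eps; split=> // i.
  by case: (leqP i k) => [/Ggf //|/G0 Gi0 _]; exact: zero_gflat.
by move=> ni; apply: G0; exact: leq_ltn_trans kn ni.
Qed.

End ZeroModule.

(** * Product modules over the product ring *)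

Section ProductModule.
Variables (I : Type) (R : I -> comPzRingType) (N : forall i, lmodType (R i)).

Definition prod_mod : Type := forall i, N i.

HB.instance Definition _ := Choice.on prod_mod.

Implicit Types x y z : prod_mod.
Let zero : prod_mod := fun=> 0.
Let opp x : prod_mod := fun i => - x i.
Let add x y : prod_mod := fun i => x i + y i.
Let scale (a : prod_ring R) x : prod_mod := fun i => a i *: x i.

Let addA : associative add.
Proof. by move=> x y z; apply: functional_extensionality_dep => i; exact: addrA.
Qed.
Let addC : commutative add.
Proof. by move=> x y; apply: functional_extensionality_dep => i; exact: addrC.
Qed.
Let add0 : left_id zero add.
Proof. by move=> x; apply: functional_extensionality_dep => i; exact: add0r.
Qed.
Let addN : left_inverse zero opp add.
Proof. by move=> x; apply: functional_extensionality_dep => i; exact: addNr.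
Qed.

HB.instance Definition _ := GRing.isZmodule.Build prod_mod addA addC add0 addN.

Let scaleA a b x : scale a (scale b x) = scale (a * b) x.
Proof. by apply: functional_extensionality_dep => i; exact: scalerA. Qed.
Let scale1 : left_id 1 scale.
Proof. by move=> x; apply: functional_extensionality_dep => i; exact: scale1r.
Qed.
Let scaleDr : right_distributive scale +%R.
Proof.
by move=> a x y; apply: functional_extensionality_dep => i; exact: scalerDr.
Qed.
Let scaleDl x : {morph scale^~ x : a b / a + b}.
Proof.
by move=> a b; apply: functional_extensionality_dep => i; exact: scalerDl.
Qed.

HB.instance Definition _ := GRing.Zmodule_isLmodule.Build (prod_ring R) prod_mod
  scaleA scale1 scaleDr scaleDl.

End ProductModule.

Section ProductMap.
Variables (I : Type) (R : I -> comPzRingType) (N N' : forall i, lmodType (R i)).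
Variable f : forall i, {linear N i -> N' i}.

Definition prod_map : {linear prod_mod N -> prod_mod N'}.
Proof.
apply: (@mk_linear _ (prod_mod N) (prod_mod N') (fun x i => f i (x i))).
by move=> s x y; apply: functional_extensionality_dep => i; exact: linearP.
Defined.

End ProductMap.

(** * Finite products: recovering a module from its components *)

Section Family.
Variables (I : finType) (R : I -> comPzRingType).
Local Notation S := (prod_ring R).

Definition prod_incl i (r : R i) : S :=
  @dfwith I (fun j => R j) (fun j => 0 : R j) i r.

Definition prod_proj i : {rmorphism S -> R i} :=
  HB.pack (fun x : S => x i)
    (GRing.isZmodMorphism.Build S (R i) (fun x : S => x i)
      (fun x y => erefl))
    (GRing.isMonoidMorphism.Build S (R i) (fun x : S => x i)
      (erefl, fun x y => erefl)).

Definition prod_factor i : factor S (R i).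
Proof.
apply: (@Factor S (R i) (prod_proj i) (@prod_incl i)) => [r|s].
  exact: dfwith_in.
apply: functional_extensionality_dep => j.
rewrite -[RHS]/(prod_incl 1 j * s j) /prod_incl.
by case: dfwithP => [|j' ij]; rewrite ?dfwith_in ?mul1r // dfwith_out // mul0r.
Defined.
Local Notation e i := (idem (prod_factor i)).

Lemma prod_idem_neq i j : i != j -> proj (prod_factor j) (e i) = 0.
Proof. exact: dfwith_out. Qed.

(** Finiteness of [I] gives this sum a meaning; reconstruction of a module from its components rests
    on it. *)
Lemma prod_sum_idem : \sum_i e i = 1 :> S.
Proof.
apply: functional_extensionality_dep => j.
rewrite -[LHS]/(proj (prod_factor j) _) raddf_sum (bigD1 j) //=.
rewrite [X in X + _](proj_idem (prod_factor j)) big1 ?addr0 // => i.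
exact: prod_idem_neq.
Qed.

Section Glue.
Variables (M : lmodType S) (N : forall i, lmodType (R i)).
Variable c : forall i, component (prod_factor i) M (N i).

(** This is the inverse of the map sending [x] to the family of the [cp (c i) x]. *)
Definition glue (x : forall i, N i) : M := \sum_i cq (c i) (x i).

Lemma glue_cp x : glue (fun i => cp (c i) x) = x.
Proof.
rewrite -[RHS]scale1r -prod_sum_idem scaler_suml.
by apply: eq_bigr => i _; exact: cpK.
Qed.

Lemma cp_glue x i : cp (c i) (glue x) = x i.
Proof.
rewrite /glue (big_morph _ (cpD (c i)) (cp0 (c i))) (bigD1 i) //= cqK.
(* For [j != i] the term is fixed by the [j]-th idempotent, whose image in [R i] is 0. *)
rewrite big1 ?addr0 // => j ji.
by rewrite -idem_cq cpZ prod_idem_neq ?scale0r.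
Qed.

Lemma cp_inj x y : (forall i, cp (c i) x = cp (c i) y) -> x = y.
Proof.
move=> xy; rewrite -(glue_cp x) -(glue_cp y).
by apply: eq_bigr => i _; rewrite xy.
Qed.

End Glue.

Definition prod_component (N : forall i, lmodType (R i)) i :
  component (prod_factor i) (prod_mod N) (N i).
Proof.
apply: (@Component _ _ (prod_factor i) (prod_mod N) (N i) (fun x => x i)
  (fun y => @dfwith I (fun j => N j) (fun j => 0 : N j) i y)) => //.
- by move=> y; exact: dfwith_in.
- move=> x; apply: functional_extensionality_dep => j.
  rewrite -[RHS]/(prod_incl 1 j *: x j) /prod_incl.
  case: dfwithP => [|j' ij]; first by rewrite dfwith_in scale1r.
  by rewrite dfwith_out // scale0r.
Defined.

Section FamilyMaps.
Variables (M M' : lmodType S) (N N' : forall i, lmodType (R i)).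
Variables (c : forall i, component (prod_factor i) M (N i)).
Variables (c' : forall i, component (prod_factor i) M' (N' i)).
Variables (f : {linear M -> M'}) (g : forall i, {linear N i -> N' i}).
Hypothesis fg : forall i, compat (c i) (c' i) f (g i).

Lemma family_inj : (forall i, injective (g i)) -> injective f.
Proof.
move=> gI x y fxy; apply: (cp_inj (c := c)) => i.
by apply: gI; rewrite -!fg fxy.
Qed.

(** Preimages are chosen in each component and glued; equality is then checked componentwise. *)
Lemma glue_image y :
  (forall i, exists x, g i x = cp (c' i) y) -> exists x, f x = y.
Proof.
move=> gx; exists (glue c (fun i => projT1 (cid (gx i)))).
apply: (cp_inj (c := c')) => i; rewrite fg cp_glue.
by case: cid.
Qed.

Lemma family_surj : (forall i, surjective_map (g i)) -> surjective_map f.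
Proof. by move=> gS y; apply: glue_image => i; exact: gS. Qed.

End FamilyMaps.

Lemma family_exact (A B C : lmodType S) (A' B' C' : forall i, lmodType (R i))
    (a : forall i, component (prod_factor i) A (A' i))
    (b : forall i, component (prod_factor i) B (B' i))
    (c : forall i, component (prod_factor i) C (C' i))
    (f : {linear A -> B}) (g : {linear B -> C})
    (f' : forall i, {linear A' i -> B' i})
    (g' : forall i, {linear B' i -> C' i}) :
  (forall i, compat (a i) (b i) f (f' i)) ->
  (forall i, compat (b i) (c i) g (g' i)) ->
  (forall i, exact_at (f' i) (g' i)) -> exact_at f g.
Proof.
move=> ff' gg' ex y; split=> [gy0|[x <-]].
  by apply: (glue_image ff') => i; apply/ex; rewrite -gg' gy0 cp0.
apply: (cp_inj (c := c)) => i; rewrite gg' ff' cp0.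
by apply/ex; exists (cp (a i) x).
Qed.

(** The components of [f] stay injective, flatness of [N i] keeps them so after tensoring, and
    injectivity is detected on components. *)
Lemma family_flat (M : lmodType S) (N : forall i, lmodType (R i)) :
  (forall i, component (prod_factor i) M (N i)) ->
  (forall i, flat (N i)) -> flat M.
Proof.
move=> c Nflat A B f fI.
pose a i := part_component (prod_factor i) A.
pose b i := part_component (prod_factor i) B.
apply: (family_inj (fun i => tens_compat (compat_id (c i))
  (compat_comp_map (a i) (b i) f))) => i.
by apply: Nflat; exact: compat_inj (compat_comp_map _ _ _) fI.
Qed.

Lemma family_gflat (M : lmodType S) (N : forall i, lmodType (R i)) :
  (forall i, component (prod_factor i) M (N i)) ->
  (forall i, gorenstein_flat (N i)) -> gorenstein_flat M.
Proof.
move=> c Ngf.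
(* One complex is chosen for each [i]; the product of these complexes is the witness for [M]. *)
pose F i := projT1 (cid (Ngf i)).
have Fflat i n : flat (term (F i) n) by rewrite /F; case: cid => ? [].
have Fex i : exact_seq (F i) by rewrite /F; case: cid => ? [].
have Fe i : exists u : {linear N i -> term (F i) (0 + 1)},
    injective u /\
    forall y, (exists x, u x = y) <-> (exists z, @diff _ (F i) 0 z = y).
  by rewrite /F; case: cid => ? /= [] _ _ [u eI eim] _; exists u.
have FI i J : injective_module J -> exact_seq (tens_seq J (F i)).
  by rewrite /F; case: cid => ? /= [] _ _ _; apply.
pose P n := prod_mod (fun i => term (F i) n).
pose p n i := prod_component (fun i => term (F i) n) i.
pose dP n : {linear P n -> P (n + 1)} := prod_map (fun i => @diff _ (F i) n).
have pd n i : compat (p n i) (p (n + 1) i) (dP n) (@diff _ (F i) n) by [].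
exists (@SeqMod S P dP); split.
- by move=> n; apply: (family_flat (p n)) => i; exact: Fflat.
- by move=> n; apply: family_exact (pd n) (pd (n + 1)) _ => i; exact: Fex.
- pose u i := projT1 (cid (Fe i)).
  have eI i : injective (u i) by rewrite /u; case: cid => ? [].
  have eim i y : (exists x, u i x = y) <-> exists z, @diff _ (F i) 0 z = y.
    by rewrite /u; case: cid => ? [].
  have le : linear (fun x => (fun i => u i (cp (c i) x)) : P (0 + 1)).
    move=> s x y; apply: functional_extensionality_dep => i.
    by rewrite cpD cpZ linearP.
  have ce i : compat (c i) (p (0 + 1) i) (mk_linear le) (u i) by [].
  exists (mk_linear le); first exact: family_inj ce eI.
  move=> y; split=> [[x <-]|[z <-]].
    by apply: (glue_image (pd 0)) => i; apply/eim; exists (cp (c i) x).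
  by apply: (glue_image ce) => i; apply/eim; exists (z i).
(* The [i]-th component of the tensored product complex is [F i] tensored with the [i]-th part of
   [J], which is injective over [R i]. *)
- move=> J Jinj n.
  pose q i := part_component (prod_factor i) J.
  have qp j i : compat (tens_component (q i) (p j i))
      (tens_component (q i) (p (j + 1) i)) (tens_map idfun (dP j))
      (tens_map idfun (@diff _ (F i) j)).
    exact: tens_compat (compat_id (q i)) (pd j i).
  apply: family_exact (qp n) (qp (n + 1)) _ => i.
  exact: FI (component_injective (q i) Jinj) n.
Qed.

(** A common length [k] makes the product of the resolutions Gorenstein flat up to degree [k] and
    zero beyond. *)
Lemma family_resolution (M : lmodType S) (N : forall i, lmodType (R i)) k :
  (forall i, component (prod_factor i) M (N i)) ->
  (forall i, gflat_resolution (N i) k) -> gflat_resolution M k.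
Proof.
move=> c Nres.
pose G i := projT1 (cid (Nres i)).
have Gd i : exists (d : forall n, {linear G i n.+1 -> G i n})
    (eps : {linear G i 0%N -> N i}),
    [/\ forall n, (n <= k)%N -> gorenstein_flat (G i n),
        forall n, (k < n)%N -> forall x : G i n, x = 0,
        surjective_map eps,
        exact_at (d 0%N) eps
      & forall n, exact_at (d n.+1) (d n)].
  by rewrite /G; case: cid.
pose d i := projT1 (cid (Gd i)).
have Geps i : exists eps : {linear G i 0%N -> N i},
    [/\ forall n, (n <= k)%N -> gorenstein_flat (G i n),
        forall n, (k < n)%N -> forall x : G i n, x = 0,
        surjective_map eps,
        exact_at (d i 0%N) eps
      & forall n, exact_at (d i n.+1) (d i n)].
  by rewrite /d; case: cid.
pose eps i := projT1 (cid (Geps i)).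
have epsP i : [/\ forall n, (n <= k)%N -> gorenstein_flat (G i n),
        forall n, (k < n)%N -> forall x : G i n, x = 0,
        surjective_map (eps i),
        exact_at (d i 0%N) (eps i)
      & forall n, exact_at (d i n.+1) (d i n)].
  by rewrite /eps; case: cid.
pose P n := prod_mod (fun i => G i n).
pose p n i := prod_component (fun i => G i n) i.
pose dP n : {linear P n.+1 -> P n} := prod_map (fun i => d i n).
have pd n i : compat (p n.+1 i) (p n i) (dP n) (d i n) by [].
(* The augmentation must land in [M] itself, not in the product of the [N i], so its values are
   glued. *)
have leps : linear (fun x : P 0%N => glue c (fun i => eps i (x i))).
  move=> s x y; apply: (cp_inj (c := c)) => i.
  by rewrite cpD cpZ !cp_glue; exact: linearP.
have ceps i : compat (p 0%N i) (c i) (mk_linear leps) (eps i).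
  by move=> x; exact: cp_glue.
exists P, dP, (mk_linear leps); split.
- move=> n nk; apply: (family_gflat (p n)) => i.
  by case: (epsP i) => Ggf _ _ _ _; exact: Ggf.
- move=> n kn x; apply: functional_extensionality_dep => i.
  by case: (epsP i) => _ G0 _ _ _; exact: G0.
- by apply: family_surj ceps _ => i; case: (epsP i).
- by apply: family_exact (pd 0%N) ceps _ => i; case: (epsP i).
- by move=> n; apply: family_exact (pd n.+1) (pd n) _ => i; case: (epsP i).
Qed.

End Family.

(** * Comparison of Gorenstein flat dimensions and suprema *)

Lemma Gfd_le (K : realType) (R : comPzRingType) (M : lmodType R) k :
  gflat_resolution M k -> (Gfd K M <= k%:R%:E)%E.
Proof.
move=> Mk; rewrite /Gfd; case: pselect => [ex_k|[]]; last first.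
  by exists k; exact/asboolP.
case: ex_minnP => n _ /(_ k (introT (asboolP _) Mk)) nk.
by rewrite lee_fin ler_nat.
Qed.

Lemma Gfd_finite (K : realType) (R : comPzRingType) (M : lmodType R) :
  Gfd K M <> +oo%E ->
  exists2 k, gflat_resolution M k & Gfd K M = k%:R%:E.
Proof.
rewrite /Gfd; case: pselect => // ex_k _.
by case: ex_minnP => n /asboolP Mn _; exists n.
Qed.

Lemma component_Gfd (K : realType) S R (phi : factor S R) (M : lmodType S)
    (N : lmodType R) : component phi M N -> (Gfd K N <= Gfd K M)%E.
Proof.
move=> c; have [->|/eqP/Gfd_finite[k Mk ->]] := eqVneq (Gfd K M) +oo%E.
  exact: leey.
exact/Gfd_le/(component_resolution c).
Qed.

Theorem theorem3p5 (K : realType) (m : nat) (hm : (1 <= m)%N)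
    (R : 'I_m -> comPzRingType) (hR : forall i, coherent (R i)) :
  Gwdim (prod_ring R) K
  = ereal_sup [set x | exists i, x = Gwdim (R i) K]%classic.
Proof.
apply/eqP; rewrite eq_le; apply/andP; split; apply: ge_ereal_sup => x [].
- move=> M ->.
  have leN i (N : lmodType (R i)) :
      (Gfd K N <= ereal_sup [set x | exists i, x = Gwdim (R i) K]%classic)%E.
    apply: le_trans (ereal_sup_ubound _); last by exists i.
    by apply: ereal_sup_ubound; exists N.
  pose N i := part (prod_factor R i) M.
  (* An infinite component dimension makes the supremum infinite; otherwise every component has a
     finite resolution. *)
  have [[i Ni]|Nfin] := pselect (exists i, Gfd K (N i) = +oo%E).
    by apply: le_trans (leN i (N i)); rewrite Ni; exact: leey.
  have Nres i : exists2 k, gflat_resolution (N i) k & Gfd K (N i) = k%:R%:E.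
    by apply: Gfd_finite => Ni; apply: Nfin; exists i.
  pose k i := projT1 (cid2 (Nres i)).
  have kres i : gflat_resolution (N i) (k i) by rewrite /k; case: cid2.
  have kE i : Gfd K (N i) = (k i)%:R%:E by rewrite /k; case: cid2.
  (* As [m >= 1], the largest length is attained at some [i0]; all the resolutions are lengthened to
     it. *)
  have [|i0 ki0] := @bigop.eq_bigmax _ k; first by rewrite card_ord.
  apply: le_trans (leN i0 (N i0)); rewrite kE -ki0; apply: Gfd_le.
  apply: (family_resolution (fun i => part_component (prod_factor R i) M)) => i.
  by apply: gflat_resolution_leq (kres i); exact: bigop.leq_bigmax.
(* Conversely, [N] is a component of its restriction to the product ring, whose dimension therefore
   bounds that of [N]. *)
- move=> i ->; apply: ge_ereal_sup => _ [N ->].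
  apply: le_trans (component_Gfd K (restrict_component (prod_factor R i) N)) _.
  by apply: ereal_sup_ubound; exists (restrict (prod_factor R i) N).
Qed.
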